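(* Fix an integer $k\ge1$. There is a constant $\hat C$ depending only on $k$ such that the AEROS recovery of the interface based on polynomials of degree $2k$ satisfies, for each singular cell $T$, the near optimality property $$\|\psi-p_T\|_{L^\infty(I_T)}\le(1+\hat C)\min_{p\in\mathbb P_{2k}}\|\psi-p\|_{L^\infty(I_T)},$$ where $\psi$ is the function whose graph describes the exact interface over the stencil $S_T$, and $p_T\in\mathbb P_{2k}$ is the polynomial recovered by AEROS from the cell averages on $S_T$.
   Context: $\mathbb P_{2k}$ is the space of univariate polynomials of degree at most $2k$. The plane is meshed by cells of side $h>0$; the cell with coordinates $(i,j)$ is $[ih,(i+1)h]\times[jh,(j+1)h]$. Let $u=\chi_\Omega$ with $\Omega\subset[0,1]^2$, and let $a_{\tilde T}(u)=\frac1{|\tilde T|}\int_{\tilde T}u$. A cell $T$ is singular if $|T\cap\Omega|\ne0$ and $|T\cap\Omega^c|\neq0$; let $(i_T,j_T)$ be its coordinates. Standing situation for AEROS (case of orientation $y\le\psi(x)$): integers $k^-,k^+\ge0$ with $k^-+k^+=2k$ and $l^-,l^+>0$ are selected, and the stencil $S_T$ consists of the cells of coordinates $(i,j)$, $i=i_T-k^-,\dots,i_T+k^+$, $j=j_T-l^-,\dots,j_T+l^+$. Let $I_T=[(i_T-k^-)h,(i_T+k^++1)h]$ and $J_T=[(j_T-l^-)h,(j_T+l^++1)h]$. Over $S_T$ the domain is described by a continuous function $\psi$ ($\psi\in\mathcal C^s$ with $s>1$ in the paper): for $(x,y)\in I_T\times J_T$, $(x,y)\in\Omega\iff y\le\psi(x)$;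 and the graph is confined in $S_T$: $\psi(I_T)\subset J_T$. AEROS recovery: for $i=i_T-k^-,\dots,i_T+k^+$ let $R_i$ be the column of cells of $S_T$ with first coordinate $i$, and put $$a_i(u)=h\sum_{\tilde T\in R_i}a_{\tilde T}(u),\qquad b_T=(j_T-l^-)h,$$ so that $a_i(u)+b_T=\frac1h\int_{ih}^{(i+1)h}\psi(x)\,dx$. Then $p_T$ is the unique polynomial in $\mathbb P_{2k}$ such that $$\frac1h\int_{ih}^{(i+1)h}p_T(x)\,dx=a_i(u)+b_T,\qquad i=i_T-k^-,\dots,i_T+k^+ .$$ The three other orientations $y\ge\psi(x)$, $x\le\psi(y)$, $x\ge\psi(y)$ are handled identically after the change of variable $y\to-y$ and/or exchange of $x$ and $y$ (with $I_T$ then denoting the corresponding interval of $2k+1$ cells in the independent variable). The constant $\hat C$ is the norm, as an operator on $L^\infty$ of an interval $\hat I$ made of $2k+1$ adjacent unit intervals, of the linear map sending a function to the unique polynomial in $\mathbb P_{2k}$ having the same averages on these unit intervals. *)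

(* Defs.v *)
From HB Require Import structures.
From mathcomp Require Import all_boot all_order all_algebra.
From mathcomp Require Import all_classical all_reals all_analysis.
Set Implicit Arguments.
Unset Strict Implicit.
Unset Printing Implicit Defensive.
Import Order.TTheory GRing.Theory Num.Theory.
Import numFieldNormedType.Exports.
Local Open Scope classical_set_scope.
Local Open Scope ring_scope.

Section OneDimension.
Variable R : realType.

Definition in_Pn (d : nat) (p : {poly R}) : Prop := (size p <= d.+1)%N.

(* [i h, (i + n) h]: n adjacent mesh intervals, the first one being number i. *)
Definition mesh_interval (h : R) (i : int) (n : nat) : set R :=
  `[i%:~R * h, (i + n%:Z)%:~R * h].

Definition mean1 (h : R) (f : R -> R) (i : int) : R :=
  h^-1 * (\int[lebesgue_measure]_(x in mesh_interval h i 1) f x)%R.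

(* Essential supremum of |f| on I; the values of f outside I are ignored. *)
Definition Linfty (I : set R) (f : R -> R) : \bar R :=
  ('N[lebesgue_measure]_+oo[(EFin \o f) \_ I])%E.

Definition has_means (d : nat) (h : R) (i0 : int) (c : nat -> R)
    (p : {poly R}) : Prop :=
  in_Pn d p /\
  forall n : nat, (n <= d)%N -> mean1 h (horner p) (i0 + n%:Z) = c n.

Definition ref_interval (d : nat) : set R := mesh_interval 1 0 d.+1.

(* has_means d 1 0 is satisfied by exactly one polynomial for any prescribed
   means, so the default value 0 of xget is never taken. *)
Definition mean_proj (d : nat) (f : R -> R) : {poly R} :=
  xget 0 [set p | has_means d 1 0 (fun n => mean1 1 f n%:Z) p].

(* Operator norm of mean_proj d on L^oo(ref_interval d), in [0, +oo]. *)
Definition mean_proj_norm (d : nat) : \bar R :=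
  ereal_sup [set Linfty (ref_interval d) (horner (mean_proj d f)) |
    f in [set f : R -> R | measurable_fun (ref_interval d) f /\
                           (Linfty (ref_interval d) f <= 1)%E]].

End OneDimension.

Section Plane.
Variable R : realType.

Definition area :
    {measure set (measurableTypeR R * measurableTypeR R) -> \bar R} :=
  (lebesgue_measure \x lebesgue_measure)%E.

Definition cell (h : R) (c : int * int) : set (R * R) :=
  mesh_interval h c.1 1 `*` mesh_interval h c.2 1.

Definition cell_mean (h : R) (u : R * R -> R) (c : int * int) : R :=
  (fine (area (cell h c)))^-1 * (\int[area]_(z in cell h c) u z)%R.

Definition singular (h : R) (Omega : set (R * R)) (c : int * int) : Prop :=
  area (cell h c `&` Omega) != 0%E /\ area (cell h c `&` ~` Omega) != 0%E.

(* The four ways in which the domain may lie with respect to the graph. *)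
Variant orientation :=
  | Y_le  (* y <= psi(x) *)
  | Y_ge  (* y >= psi(x) *)
  | X_le  (* x <= psi(y) *)
  | X_ge  (* x >= psi(y) *).

(* The pair (x, y) whose independent variable (the argument of psi) is s and
   whose dependent variable is t; used for points and for cell coordinates. *)
Definition place (A : Type) (o : orientation) (s t : A) : A * A :=
  match o with Y_le | Y_ge => (s, t) | X_le | X_ge => (t, s) end.

Definition side (o : orientation) (t v : R) : Prop :=
  match o with Y_le | X_le => t <= v | Y_ge | X_ge => v <= t end.

(* A stencil around the cell T = place o iT jT: km cells before and kp cells
   after T along the independent variable, lm and lp along the other one. *)
Record stencil := Stencil { iT : int; jT : int;
                            km : nat; kp : nat; lm : nat; lp : nat }.

Definition target_cell (o : orientation) (S : stencil) : int * int :=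
  place o (iT S) (jT S).

Definition I_ (h : R) (S : stencil) : set R :=
  mesh_interval h (iT S - (km S)%:Z) (km S + kp S).+1.

Definition J_ (h : R) (S : stencil) : set R :=
  mesh_interval h (jT S - (lm S)%:Z) (lm S + lp S).+1.

Definition graph_described (o : orientation) (h : R) (S : stencil)
    (Omega : set (R * R)) (psi : R -> R) : Prop :=
  forall s t : R, I_ h S s -> J_ h S t ->
    (Omega (place o s t) <-> side o t (psi s)).

(* h times the sum of the cell means over the n-th column of the stencil (a row
   of cells when the independent variable is y). *)
Definition column_sum (o : orientation) (h : R) (S : stencil)
    (u : R * R -> R) (n : nat) : R :=
  h * \sum_(0 <= m < (lm S + lp S).+1)
        cell_mean h u
          (place o (iT S - (km S)%:Z + n%:Z) (jT S - (lm S)%:Z + m%:Z)).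

(* The means prescribed to the recovered polynomial. In the "ge" cases, t -> -t
   turns the bottom of J into minus its top, hence means - a_n + top of J for
   -psi in place of psi. *)
Definition aeros_data (o : orientation) (h : R) (S : stencil)
    (u : R * R -> R) (n : nat) : R :=
  match o with
  | Y_le | X_le => column_sum o h S u n + (jT S - (lm S)%:Z)%:~R * h
  | Y_ge | X_ge => (jT S + (lp S)%:Z + 1)%:~R * h - column_sum o h S u n
  end.

Definition aeros (o : orientation) (h : R) (S : stencil) (u : R * R -> R)
    (p : {poly R}) : Prop :=
  has_means (km S + kp S) h (iT S - (km S)%:Z) (aeros_data o h S u) p.

End Plane.

(* Main.v *)
Require Import Defs.
From HB Require Import structures.
From mathcomp Require Import all_boot all_order all_algebra.
From mathcomp Require Import all_classical all_reals all_analysis.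
From mathcomp Require Import qpoly ess_sup_inf measurable_realfun ring lra zify.
Set Implicit Arguments.
Unset Strict Implicit.
Unset Printing Implicit Defensive.
Import Order.TTheory GRing.Theory Num.Theory.
Import numFieldNormedType.Exports.
Local Open Scope classical_set_scope.
Local Open Scope ring_scope.

(** The recovery is a projection, and projections are quasi-optimal. A polynomial
of degree at most d is determined by its means over d + 1 adjacent mesh
intervals: its primitive is determined, up to a constant, by the increments
between the d + 2 nodes, so uniqueness is the root count
([zero_means_poly_eq0]) and existence is Lagrange interpolation of the primitive
([has_means_exists]). Hence the map Pi from functions to polynomials with the
same means is well defined, linear, and the identity on polynomials.

Each coefficient of Pi f in the basis dual to the means is a mean of f, hence
at most the sup norm of f; so Pi has finite norm C on the reference interval
([mean_proj_norm_fin]). An affine change of variable preserves both means and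
sup norms, so the same C works on every mesh. For any q of degree at most d,
psi - Pi psi = (psi - q) - Pi (psi - q), which gives the factor 1 + C
([mean_projection_quasi_optimal]). A best q exists by compactness
([best_approx]).

It remains to see that the data of the recovery are the means of psi
([aeros_data_mean]). By Tonelli, the mean of the indicator over a cell is, up to
the factor h^-2, the integral over its base of the length of the part of the
vertical fibre which lies in the domain. On the fibre [a, b] this length is min(v, b) - min(v, a)
when the domain is below the value v of psi, and max(v, b) - max(v, a) when it
is above. Over a column these differences telescope, and since the graph stays
inside the stencil only psi and one end of the column remain. *)

(** * Polynomials and their means over mesh intervals *)

Definition primitive (R : realType) (p : {poly R}) : {poly R} :=
  \poly_(i < (size p).+1) (p`_i.-1 / i%:R).

Lemma deriv_primitive (R : realType) (p : {poly R}) : (primitive p)^`() = p.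
Proof.
apply/polyP => i; rewrite coef_deriv coef_poly /= ltnS.
case: ltnP => [_|/leq_sizeP/(_ i (leqnn i)) ->]; last by rewrite mul0rn.
by rewrite -[LHS]mulr_natr divfK// pnatr_eq0.
Qed.

Lemma size_primitive (R : realType) (p : {poly R}) :
  (size (primitive p) <= (size p).+1)%N.
Proof. exact: size_poly. Qed.

Lemma mesh_step_gt0 (R : realType) (h : R) (i : int) : 0 < h ->
  i%:~R * h < (i + 1%:Z)%:~R * h.
Proof. by move=> h0; rewrite ltr_pM2r// ltr_int ltrDl. Qed.

Lemma mean1_deriv (R : realType) (h : R) (P : {poly R}) (i : int) : 0 < h ->
  mean1 h (horner P^`()) i =
  h^-1 * (P.[(i + 1%:Z)%:~R * h] - P.[i%:~R * h]).
Proof.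
move=> h0; rewrite /mean1 /mesh_interval /Rintegral.
rewrite (@continuous_FTC2 _ _ (horner P)) //=.
- exact: mesh_step_gt0.
- by apply: continuous_subspaceT => x; exact: continuous_horner.
- split; first by move=> x _; exact: derivable_horner.
  + by apply: cvg_at_right_filter; exact: continuous_horner.
  + by apply: cvg_at_left_filter; exact: continuous_horner.
- by move=> x _; rewrite derivE.
Qed.

Lemma mesh_node_inj (R : realType) (h : R) (i0 : int) : 0 < h ->
  injective (fun n : nat => (i0 + n%:Z)%:~R * h).
Proof.
move=> h0 m n /(mulIf (lt0r_neq0 h0))/eqP.
by rewrite eqr_int => /eqP/addrI[].
Qed.

Lemma mesh_nodeS (i0 : int) (n : nat) : i0 + n%:Z + 1%:Z = i0 + n.+1%:Z.
Proof. lia. Qed.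

(** Zero means say that a primitive takes the same value at the d + 2 nodes, so it
is constant: its degree is at most d + 1. *)
Lemma zero_means_poly_eq0 (R : realType) (d : nat) (h : R) (i0 : int)
    (p : {poly R}) : 0 < h -> in_Pn d p ->
  (forall n, (n <= d)%N -> mean1 h (horner p) (i0 + n%:Z) = 0) -> p = 0.
Proof.
move=> h0 dp p0; pose P := primitive p.
have PE n : (n <= d.+1)%N -> P.[(i0 + n%:Z)%:~R * h] = P.[i0%:~R * h].
  elim: n => [|n IH] nd; first by rewrite addr0.
  rewrite -(IH (ltnW nd)); move: (p0 _ nd).
  rewrite -{1}(deriv_primitive p) mean1_deriv// mesh_nodeS.
  by move/eqP; rewrite mulf_eq0 invr_eq0 gt_eqF//= subr_eq0 => /eqP.
have /eqP : P - (P.[i0%:~R * h])%:P = 0.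
  apply: (@roots_geq_poly_eq0 _ _
    [seq (i0 + n%:Z)%:~R * h | n <- iota 0 d.+2]).
  - apply/allP => x /mapP[n]; rewrite mem_iota add0n ltnS => /andP[_ nd] ->.
    by rewrite rootE hornerD hornerN hornerC PE// subrr.
  - by rewrite map_inj_uniq ?iota_uniq//; exact: mesh_node_inj.
  - rewrite size_map size_iota (leq_trans (size_polyD _ _))// geq_max.
    rewrite (leq_trans (size_primitive _))//= size_polyN.
    by rewrite (leq_trans (size_polyC_leq1 _)).
by rewrite subr_eq0 => /eqP PC; rewrite -(deriv_primitive p) -/P PC derivC.
Qed.

(** Through primitives, linearity of the mean needs no integrability argument. *)
Lemma mean1_poly_lin (R : realType) (h a : R) (p q : {poly R}) (i : int) :
  0 < h ->
  mean1 h (horner (a *: p + q)) i =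
  a * mean1 h (horner p) i + mean1 h (horner q) i.
Proof.
move=> h0; rewrite -(deriv_primitive p) -(deriv_primitive q).
by rewrite -derivZ -derivD !mean1_deriv// !hornerD !hornerZ; ring.
Qed.

Lemma has_means_lin (R : realType) (d : nat) (h a : R) (i0 : int)
    (c c' : nat -> R) (p q : {poly R}) : 0 < h ->
  has_means d h i0 c p -> has_means d h i0 c' q ->
  has_means d h i0 (fun n => a * c n + c' n) (a *: p + q).
Proof.
move=> h0 [dp pc] [dq qc]; split.
  rewrite /in_Pn (leq_trans (size_polyD _ _))// geq_max.
  by rewrite (leq_trans (size_scale_leq _ _)).
by move=> n nd; rewrite mean1_poly_lin// pc// qc.
Qed.

Lemma has_means0 (R : realType) (d : nat) (h : R) (i0 : int) : 0 < h ->
  has_means d h i0 (fun=> 0) 0.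
Proof.
move=> h0; split=> [|n _]; first by rewrite /in_Pn size_poly0.
by rewrite -(deriv0 R) mean1_deriv// !horner0 subrr mulr0.
Qed.

Lemma has_means_sum (R : realType) (d : nat) (h : R) (i0 : int)
    (c : nat -> nat -> R) (a : nat -> R) (p : nat -> {poly R}) (m : nat) :
  0 < h ->
  (forall j, (j < m)%N -> has_means d h i0 (c j) (p j)) ->
  has_means d h i0 (fun n => \sum_(j < m) a j * c j n)
    (\sum_(j < m) a j *: p j).
Proof.
move=> h0; elim: m => [|m IH] cp.
  rewrite big_ord0 (_ : (fun=> _) = fun=> 0); first exact: has_means0.
  by apply/funext => n; rewrite big_ord0.
rewrite big_ord_recr /= addrC (_ : (fun=> _) =
  fun n => a m * c m n + \sum_(j < m) a j * c j n); last first.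
  by apply/funext => n; rewrite big_ord_recr /= addrC.
apply: has_means_lin => //; first exact: cp.
by apply: IH => j jm; apply: cp; exact: ltnW.
Qed.

Lemma has_means_uniq (R : realType) (d : nat) (h : R) (i0 : int)
    (c : nat -> R) (p q : {poly R}) : 0 < h ->
  has_means d h i0 c p -> has_means d h i0 c q -> p = q.
Proof.
move=> h0 hp hq.
have [dn pqn] := has_means_lin (-1) h0 hp hq.
apply/esym/eqP; rewrite -subr_eq0 -scaleN1r addrC; apply/eqP.
apply: (zero_means_poly_eq0 (i0 := i0) h0 dn) => n nd.
by rewrite pqn// mulN1r addNr.
Qed.

(** Interpolate a primitive: its values at the nodes are the partial sums of the
prescribed integrals. *)
Lemma has_means_exists (R : realType) (d : nat) (h : R) (i0 : int)
    (c : nat -> R) : 0 < h -> exists p, has_means d h i0 c p.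
Proof.
move=> h0; pose x n : R := (i0 + n%:Z)%:~R * h.
have xinj : injective x by exact: mesh_node_inj.
pose y n := h * \sum_(m < n) c m.
pose P := \sum_(j < d.+2) y j *: (tnth (lagrange d.+2 x) j : {poly R}).
have Px n : (n < d.+2)%N -> P.[x n] = y n.
  move=> nd; rewrite horner_sum (bigD1 (Ordinal nd))//= hornerZ.
  rewrite (@lagrange_sample _ d.+2 _ isT xinj _ (Ordinal nd)) eqxx mulr1.
  rewrite big1 ?addr0// => j jn; rewrite hornerZ.
  rewrite (@lagrange_sample _ d.+2 _ isT xinj _ (Ordinal nd)).
  by rewrite (negbTE jn) mulr0.
have sP : (size P <= d.+2)%N.
  rewrite (leq_trans (size_sum _ _ _))//; apply/bigmax_leqP => j _.
  by rewrite (leq_trans (size_scale_leq _ _))// size_lagrange_.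
exists P^`(); split.
  rewrite /in_Pn; have [->|P0] := eqVneq P 0.
    by rewrite deriv0 size_poly0.
  by rewrite -ltnS (leq_trans (lt_size_deriv P0)).
move=> n nd; rewrite mean1_deriv// mesh_nodeS !Px//; last by rewrite ltnS ltnW.
rewrite /y -mulrBr big_ord_recr /= addrAC subrr add0r mulKf//.
exact: lt0r_neq0.
Qed.

(** * Essential suprema, means and changes of variable *)

Lemma Linfty_ge0 (R : realType) (I : set R) (f : R -> R) :
  (0 <= Linfty I f)%E.
Proof. exact: Lnorm_ge0. Qed.

(** The sign condition on M accounts for the value 0 given to the function
outside I. *)
Lemma Linfty_aeP (R : realType) (I : set R) (f : R -> R) (M : R) : 0 <= M ->
  (Linfty I f <= M%:E)%E <->
  {ae (lebesgue_measure : {measure set (measurableTypeR R) -> \bar R}),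
    forall x, I x -> `|f x| <= M}.
Proof.
move=> M0; rewrite /Linfty unlock.
have -> : (0 < @lebesgue_measure R setT)%E.
  by rewrite -set_itvNyy lebesgue_measure_itv /= ltry.
split=> [/ess_supP fM|fM].
  apply: filterS fM => x /= + Ix; rewrite patchE mem_set//.
case: fM => N [mN N0 fN]; apply/ess_supP; exists N; split=> // x /= xM.
apply: fN => /= fM; apply: xM; rewrite patchE; case: ifPn => [/set_mem/fM//|_].
by rewrite abse0 lee_fin.
Qed.

(** A point where |f| exceeds M has a relative neighbourhood in [a, b] where it
still does, and such a neighbourhood contains an interval of positive length. *)
Lemma Linfty_continuousP (R : realType) (a b : R) (f : R -> R) (M : R) :
  a < b -> {within `[a, b], continuous f} ->
  (Linfty `[a, b] f <= M%:E)%E <-> (forall x, x \in `[a, b] -> `|f x| <= M).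
Proof.
move=> ab cf; have [M0|M0] := leP 0 M; last first.
  split=> [|/(_ a)]; first
    by move=> /(le_trans (Linfty_ge0 _ _)); rewrite lee_fin leNgt M0.
  rewrite in_itv/= lexx ltW// => /(_ isT) /(le_trans (normr_ge0 _)).
  by rewrite leNgt M0.
rewrite Linfty_aeP//; split=> [|fM]; last first.
  by apply: nearW => x; exact: fM.
move=> [N [mN N0 fN]] x xab; rewrite leNgt; apply/negP => Mfx.
have /subspace_continuousP/(_ x xab)/cvgrPdist_lt/(_ (`|f x| - M)) := cf.
rewrite subr_gt0 => /(_ Mfx); rewrite near_withinE => -[/= e e0 xe].
(* This open interval is nonempty even when x is an end point of [a, b]. *)
have : `]Num.max a (x - e), Num.min b (x + e)[ `<=` N.
  move=> y /=; rewrite in_itv/= gt_max lt_min.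
  move=> /andP[/andP[ay xy] /andP[yb yx]].
  apply: fN => /= fyM.
  have yab : y \in `[a, b] by rewrite in_itv/= !ltW.
  have := xe y; rewrite /= ltr_distlC xy/= yx => /(_ isT yab).
  have := fyM yab; have := ler_dist_dist (f x) (f y).
  have := ler_norm (`|f x| - `|f y|); lra.
move=> IN.
have : lebesgue_measure (`]Num.max a (x - e), Num.min b (x + e)[ : set R) = 0%E.
  exact: (@subset_measure0 _ (measurableTypeR R) _ lebesgue_measure
            _ _ (measurable_itv _) mN IN N0).
rewrite lebesgue_measure_itv /= ifT; last first.
  rewrite lte_fin gt_max !lt_min ab; move: xab; rewrite in_itv/= => /andP[ax xb].
  by apply/and3P; split; lra.
move=> /eqP; rewrite -EFinB eqe subr_eq0 => /eqP eqmm.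
have : Num.max a (x - e) < Num.min b (x + e); last by rewrite eqmm ltxx.
move: xab; rewrite gt_max !lt_min ab in_itv/= => /andP[ax xb].
by apply/and3P; split; lra.
Qed.

Lemma mesh_interval_measure (R : realType) (h : R) (i : int) : 0 < h ->
  lebesgue_measure (mesh_interval h i 1) = h%:E.
Proof.
move=> h0; rewrite lebesgue_measure_itv /= lte_fin mesh_step_gt0//.
rewrite -EFinB; congr EFin; rewrite intrD; ring.
Qed.

(** Averaging does not increase the essential supremum. Integrability is part of
the conclusion because it follows from the same bound. *)
Lemma mean1_bounded (R : realType) (D : set R) (f : R -> R) (h M : R)
    (i : int) : 0 < h -> measurable D -> measurable_fun D f ->
  mesh_interval h i 1 `<=` D -> (Linfty D f <= M%:E)%E ->
  lebesgue_measure.-integrable (mesh_interval h i 1) (EFin \o f) /\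
  `|mean1 h f i| <= M.
Proof.
move=> h0 mD mf iD fM.
have M0 : 0 <= M by rewrite -lee_fin (le_trans (Linfty_ge0 _ _) fM).
have mI : measurable (mesh_interval h i 1) by exact: measurable_itv.
have mfI : measurable_fun (mesh_interval h i 1) f by exact: measurable_funS mf.
have mEf := (measurable_EFinP _ _).2 mfI.
have fint : (\int[lebesgue_measure]_(x in mesh_interval h i 1) `|(f x)%:E|
    <= (M * h)%:E)%E.
  rewrite EFinM -(mesh_interval_measure i h0) -integral_cst//.
  apply: ae_ge0_le_integral => //.
  - exact: measurableT_comp.
  - have [N [mN N0 fN]] := (Linfty_aeP D f M0).1 fM.
    exists N; split=> // x /= fMx; apply: fN => /= fDM; apply: fMx => Ix.
    by rewrite lee_fin fDM//; exact: iD.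
have If : lebesgue_measure.-integrable (mesh_interval h i 1) (EFin \o f).
  by apply/integrableP; split=> //; rewrite (le_lt_trans fint)// ltry.
split=> //; rewrite /mean1 normrM gtr0_norm ?invr_gt0//.
rewrite ler_pdivrMl// mulrC -lee_fin (le_trans _ fint)//.
rewrite EFin_normr_Rintegral//; exact: le_abse_integral.
Qed.

Lemma within_continuous_comp_homo (T U V : topologicalType) (A : set T)
    (B : set U) (F : T -> U) (f : U -> V) :
  continuous F -> {homo F : x / A x >-> B x} ->
  {within B, continuous f} -> {within A, continuous (f \o F)}.
Proof.
move=> cF AB /subspace_continuousP cf; apply/subspace_continuousP => x Ax.
apply: cvg_comp (cf _ (AB _ Ax)) => P /= BP.
have : nbhs (F x) (fun y => B y -> P y) by exact: BP.
move=> /cF FB; change (nbhs x (fun t => A t -> P (F t))).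
by apply: (@filterS _ (nbhs x) _ _ _ _ FB) => t /= + At; apply; exact: AB.
Qed.

Lemma continuous_affine (R : realType) (a h : R) :
  continuous (fun t : R => (a + t) * h).
Proof.
move=> x; apply: cvgM; last exact: cvg_cst.
by apply: cvgD; [exact: cvg_cst|exact: cvg_id].
Qed.

Lemma mean1_rescale (R : realType) (f : R -> R) (h : R) (i0 n : int) : 0 < h ->
  {within mesh_interval h (i0 + n) 1, continuous f} ->
  mean1 h f (i0 + n) = mean1 1 (fun t => f ((i0%:~R + t) * h)) n.
Proof.
move=> h0 cf; pose F t := (i0%:~R + t) * h.
have FP : F = horner ((i0%:~R%:P + 'X) * h%:P).
  by apply/funext => t; rewrite !hornerE.
have F'E : F^`()%classic = cst h.
  apply/funext => t.
  by rewrite FP -derivE derivM derivD derivX !derivC !hornerE.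
have FE m : F (m%:~R * 1) = (i0 + m)%:~R * h by rewrite /F mulr1 intrD.
have cF : continuous F by exact: continuous_affine.
rewrite /mean1 invr1 mul1r {1}/mesh_interval -addrA -!FE /Rintegral.
rewrite (integration_by_substitution_increasing (F := F)).
- have cfF : {within mesh_interval 1 n 1, continuous (f \o F)}.
    apply: within_continuous_comp_homo cf => // t.
    rewrite /mesh_interval/= !in_itv/= !mulr1 => /andP[nt tn].
    by rewrite /F !intrD -!addrA !ler_pM2r// !lerD2l nt -intrD.
  have IfF : lebesgue_measure.-integrable (mesh_interval 1 n 1)
      (EFin \o (f \o F)).
    by apply: continuous_compact_integrable => //; exact: segment_compact.
  rewrite F'E; transitivity (h^-1 *
      \int[lebesgue_measure]_(x in mesh_interval 1 n 1) ((f \o F) x * h)) => //.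
  rewrite RintegralZr//; last exact: measurable_itv.
  by rewrite mulrCA mulVf ?lt0r_neq0// mulr1.
- by rewrite ltW// mesh_step_gt0.
- by move=> x y _ _ xy; rewrite ltr_pM2r// ltrD2l.
- by rewrite F'E => x _; exact: cvg_cst.
- by rewrite F'E; exact: is_cvg_cst.
- by rewrite F'E; exact: is_cvg_cst.
- split.
  + by rewrite FP => x _; exact: derivable_horner.
  + by apply: cvg_at_right_filter; exact: cF.
  + by apply: cvg_at_left_filter; exact: cF.
- by rewrite !FE addrA.
Qed.

(** * The projection preserving means *)

Lemma sub_mesh_interval (R : realType) (h : R) (i0 : int) (n m : nat) : 0 < h ->
  (n < m)%N -> mesh_interval h (i0 + n%:Z) 1 `<=` mesh_interval h i0 m.
Proof.
move=> h0 nm x; rewrite /mesh_interval/= !in_itv/= => /andP[nx xn].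
apply/andP; split.
  by apply: le_trans nx; rewrite ler_pM2r// ler_int lerDl.
apply: le_trans xn _; rewrite ler_pM2r// ler_int; lia.
Qed.

Lemma mesh_interval_gt0 (R : realType) (h : R) (i0 : int) (m : nat) : 0 < h ->
  i0%:~R * h < (i0 + m.+1%:Z)%:~R * h.
Proof. by move=> h0; rewrite ltr_pM2r// ltr_int ltrDl. Qed.

Lemma within_continuous_horner (R : realType) (I : set R) (p : {poly R}) :
  {within I, continuous (horner p)}.
Proof. by apply: continuous_subspaceT => x; exact: continuous_horner. Qed.

Lemma horner_bounded (R : realType) (a b : R) (p : {poly R}) : a <= b ->
  exists K, 0 <= K /\ forall x, x \in `[a, b] -> `|p.[x]| <= K.
Proof.
move=> ab; have cp : {within `[a, b], continuous (fun x => `|p.[x]|)}.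
  apply: continuous_subspaceT => x; apply: continuous_comp.
    exact: continuous_horner.
  exact: norm_continuous.
have [c _ pc] := EVT_max ab cp.
by exists `|p.[c]|; split.
Qed.

Lemma Linfty_continuous_fin_num (R : realType) (a b : R) (f : R -> R) :
  a < b -> {within `[a, b], continuous f} -> Linfty `[a, b] f \is a fin_num.
Proof.
move=> ab cf; have cn : {within `[a, b], continuous (fun x => `|f x|)}.
  by apply: within_continuous_comp cf => x _; exact: norm_continuous.
have [c _ fc] := EVT_max (ltW ab) cn.
rewrite ge0_fin_numE ?Linfty_ge0//.
by rewrite (le_lt_trans ((Linfty_continuousP _ ab cf).2 fc))// ltry.
Qed.

(** The basis dual to the means, so that the coefficients of a polynomial are its
own means. The sup bounds K are recorded with it since both the norm of the
projection and the compactness argument for best approximation rest on them. *)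
Lemma mean_basis (R : realType) (d : nat) (h : R) (i0 : int) : 0 < h ->
  exists phi : nat -> {poly R}, exists K : nat -> R,
  [/\ forall j, (j <= d)%N -> has_means d h i0 (fun n => (n == j)%:R) (phi j),
      forall c p, has_means d h i0 c p -> p = \sum_(j < d.+1) c j *: phi j,
      forall j, 0 <= K j &
      forall j x, x \in `[i0%:~R * h, (i0 + d.+1%:Z)%:~R * h] ->
        `|(phi j).[x]| <= K j].
Proof.
move=> h0.
have /choice[phi hphi] : forall j : nat, exists p : {poly R},
    has_means d h i0 (fun n => (n == j)%:R) p.
  by move=> j; exact: has_means_exists.
have /choice[K hK] : forall j, exists K, 0 <= K /\
    forall x, x \in `[i0%:~R * h, (i0 + d.+1%:Z)%:~R * h] -> `|(phi j).[x]| <= K.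
  by move=> j; apply: horner_bounded; rewrite ltW// mesh_interval_gt0.
exists phi, K; split; [by move=> j _| |by move=> j; have [] := hK j|
  by move=> j; have [] := hK j].
move=> c p hp; apply: (has_means_uniq h0 hp).
have [sS mS] := has_means_sum (m := d.+1) c h0 (fun j _ => hphi j).
split=> // n nd; rewrite mS// (bigD1 (Ordinal (nd : (n < d.+1)%N)))//= eqxx mulr1.
rewrite big1 ?addr0// => j /eqP jn; case: eqP => [nj|]; last by rewrite mulr0.
by exfalso; apply: jn; exact/val_inj.
Qed.

Lemma mean_projP (R : realType) (d : nat) (f : R -> R) :
  has_means d 1 0 (fun n => mean1 1 f n%:Z) (mean_proj d f).
Proof.
have [p hp] := has_means_exists d 0 (fun n => mean1 1 f n%:Z) (@ltr01 R).
by rewrite /mean_proj; exact: (xgetI _ hp).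
Qed.

Lemma mean_proj_uniq (R : realType) (d : nat) (f : R -> R) (p : {poly R}) :
  has_means d 1 0 (fun n => mean1 1 f n%:Z) p -> mean_proj d f = p.
Proof. exact: has_means_uniq (@ltr01 R) (mean_projP d f). Qed.

Lemma Linfty_polyP (R : realType) (h : R) (i0 : int) (d : nat) (p : {poly R})
    (M : R) : 0 < h ->
  (Linfty (mesh_interval h i0 d.+1) (horner p) <= M%:E)%E <->
  (forall x, x \in `[i0%:~R * h, (i0 + d.+1%:Z)%:~R * h] -> `|p.[x]| <= M).
Proof.
move=> h0; apply: Linfty_continuousP; first exact: mesh_interval_gt0.
exact: within_continuous_horner.
Qed.

Lemma mean_proj_norm_fin (R : realType) (d : nat) :
  exists C : R, C%:E = mean_proj_norm R d.
Proof.
have [phi [K [_ hp K0 phiK]]] := @mean_basis R d 1 0 ltr01.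
have nle : (mean_proj_norm R d <= (\sum_(j < d.+1) K j)%:E)%E.
  apply: ub_ereal_sup => _ [f [mf f1] <-].
  apply/Linfty_polyP => // x xI; rewrite (hp _ _ (mean_projP d f)).
  rewrite horner_sum (le_trans (ler_norm_sum _ _ _))// ler_sum// => j _.
  rewrite hornerZ normrM -[leRHS]mul1r ler_pM//; last exact: phiK.
  have jI : mesh_interval 1 (j : nat)%:Z 1 `<=` @ref_interval R d.
    by rewrite -[X in mesh_interval 1 X]add0r; exact: sub_mesh_interval.
  by have [] := mean1_bounded (@ltr01 R) (measurable_itv _) mf jI f1.
have nge : (0 <= mean_proj_norm R d)%E.
  apply: le_trans (Linfty_ge0 _ _) _; apply: ereal_sup_ubound.
  exists (cst 0) => //; split; first exact: measurable_cst.
  by apply/Linfty_aeP => //; apply: nearW => x _; rewrite normr0.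
exists (fine (mean_proj_norm R d)).
by rewrite fineK// ge0_fin_numE// (le_lt_trans nle)// ltry.
Qed.

(** Homogeneity extends the bound on the unit ball to all continuous functions.
When M = 0 no rescaling is possible, but then the means of g vanish. *)
Lemma mean_proj_bound (R : realType) (d : nat) (C : R) (g : R -> R) (M : R) :
  C%:E = mean_proj_norm R d -> {within @ref_interval R d, continuous g} ->
  (forall t, t \in `[0%:~R * 1, (0 + d.+1%:Z)%:~R * 1] -> `|g t| <= M) ->
  forall t, t \in `[0%:~R * 1, (0 + d.+1%:Z)%:~R * 1] ->
    `|(mean_proj d g).[t]| <= C * M.
Proof.
move=> CE cg gM.
have Ig n : (n <= d)%N ->
    lebesgue_measure.-integrable (mesh_interval 1 n%:Z 1) (EFin \o g).
  move=> nd; apply: continuous_compact_integrable; first exact: segment_compact.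
  apply: continuous_subspaceW cg; rewrite -[Posz n]add0r.
  exact: sub_mesh_interval.
have : 0 <= M.
  apply: le_trans (gM (0%:~R * 1) _) => //; rewrite in_itv/= lexx ltW//.
  exact: mesh_interval_gt0.
rewrite le_eqVlt => /predU1P[M0 t tI|M0].
  rewrite (mean_proj_uniq (p := 0)) ?horner0 ?normr0 -?M0 ?mulr0//.
  have [s0 m0] := has_means0 d 0 (@ltr01 R); split=> // n nd.
  rewrite m0// /mean1 invr1 mul1r (@eq_Rintegral _ _ _ _ _ (cst 0)).
    by rewrite Rintegral_cst ?mul0r//; exact: measurable_itv.
  move=> x; rewrite inE -[Posz n]add0r.
  move=> /(sub_mesh_interval ltr01 (m := d.+1) nd) xI.
  by apply/eqP; rewrite -normr_le0 M0 gM.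
move=> t tI; pose f x := M^-1 * g x.
have cf : {within @ref_interval R d, continuous f}.
  apply: (@within_continuous_comp _ _ _ _ g (fun y => M^-1 * y)) cg => y _.
  by apply: cvgM; [exact: cvg_cst|exact: cvg_id].
have fE : mean_proj d f = M^-1 *: mean_proj d g + 0.
  apply: mean_proj_uniq.
  have [sf mf] :=
    has_means_lin M^-1 (@ltr01 R) (mean_projP d g) (has_means0 d 0 ltr01).
  split=> // n nd; rewrite mf// addr0 /mean1 RintegralZl//; last exact: Ig.
    by rewrite mulrCA.
  exact: measurable_itv.
have /Linfty_polyP/(_ t tI) : (Linfty (mesh_interval 1 0 d.+1)
    (horner (mean_proj d f)) <= C%:E)%E.
  rewrite CE; apply: ereal_sup_ubound; exists f => //; split.
    by apply: subspace_continuous_measurable_fun cf; exact: measurable_itv.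
  apply/Linfty_continuousP => //; first exact: mesh_interval_gt0.
  move=> x xI; rewrite /f normrM gtr0_norm ?invr_gt0//.
  by rewrite ler_pdivrMl// mulr1 gM.
rewrite fE addr0 hornerZ normrM gtr0_norm ?invr_gt0//.
by rewrite ler_pdivrMl// mulrC; apply.
Qed.

(** In the coordinates given by the means, the error F is Lipschitz, hence
continuous. Outside the compact box of coordinates of size at most 2 F(0) the
error is larger than F(0), because the means of a polynomial are bounded by its
sup norm; so the minimum of F over the box is global. *)
Lemma best_approx (R : realType) (d : nat) (h : R) (i0 : int) (psi : R -> R) :
  0 < h -> {within mesh_interval h i0 d.+1, continuous psi} ->
  exists2 q : {poly R}, in_Pn d q &
    forall p, in_Pn d p ->
     (Linfty (mesh_interval h i0 d.+1) (fun x => psi x - q.[x])%R <=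
      Linfty (mesh_interval h i0 d.+1) (fun x => psi x - p.[x])%R)%E.
Proof.
move=> h0 cpsi; set I := mesh_interval h i0 d.+1.
have [phi [K [hphi hp K0 phiK]]] := mean_basis d i0 h0.
pose pv (v : 'rV[R]_d.+1) : {poly R} := \sum_(j < d.+1) v ord0 j *: phi j.
have pvE (v : 'rV[R]_d.+1) x : (pv v).[x] = \sum_(j < d.+1) v ord0 j * (phi j).[x].
  by rewrite horner_sum; apply: eq_bigr => j _; rewrite hornerZ.
have hpv (v : 'rV[R]_d.+1) : has_means d h i0
    (fun n => \sum_(j < d.+1) v ord0 j * (n == j)%:R) (pv v).
  have := has_means_sum (m := d.+1) (fun n => v ord0 (inord n)) h0 hphi.
  rewrite /pv; under [X in has_means _ _ _ _ X]eq_bigr do rewrite inord_val.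
  congr (has_means _ _ _ _ _); apply/funext => n.
  by apply: eq_bigr => j _; rewrite inord_val.
pose E (v : 'rV[R]_d.+1) := Linfty I (fun x => psi x - (pv v).[x]).
have cE (v : 'rV[R]_d.+1) : {within I, continuous (fun x => psi x - (pv v).[x])}.
  apply: within_continuousB => //; exact: within_continuous_horner.
have EP (v : 'rV[R]_d.+1) M : (E v <= M%:E)%E <-> (forall x,
    x \in `[i0%:~R * h, (i0 + d.+1%:Z)%:~R * h] -> `|psi x - (pv v).[x]| <= M).
  by apply: Linfty_continuousP => //; exact: mesh_interval_gt0.
pose F (v : 'rV[R]_d.+1) := fine (E v).
have EF (v : 'rV[R]_d.+1) : E v = (F v)%:E.
  by rewrite /F fineK// Linfty_continuous_fin_num// mesh_interval_gt0.
have FP (v : 'rV[R]_d.+1) x : x \in `[i0%:~R * h, (i0 + d.+1%:Z)%:~R * h] ->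
    `|psi x - (pv v).[x]| <= F v.
  by move: x; apply/EP; rewrite EF.
have Flip (v w : 'rV[R]_d.+1) e : 0 <= e ->
    (forall j, `|v ord0 j - w ord0 j| <= e) ->
    F v <= F w + e * \sum_(j < d.+1) K j.
  move=> e0 vw; rewrite -lee_fin -EF; apply/EP => x xI.
  have -> : psi x - (pv v).[x] = (psi x - (pv w).[x]) - ((pv v).[x] - (pv w).[x]).
    ring.
  rewrite (le_trans (ler_normB _ _))// lerD ?FP//.
  rewrite !pvE -sumrB mulr_sumr (le_trans (ler_norm_sum _ _ _))// ler_sum// => j _.
  by rewrite -mulrBl normrM ler_pM// phiK.
have cF : continuous F.
  move=> v; apply/(@cvgrPdist_le _ _ _ (nbhs (v : 'rV[R]_d.+1))) => e e0.
  pose S := 1 + \sum_(j < d.+1) K j.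
  have S0 : 0 < S by rewrite ltr_wpDr// sumr_ge0.
  apply/nbhs_ballP; exists (e / S) => /=; first by rewrite divr_gt0.
  move=> w vw; have vwj j : `|v ord0 j - w ord0 j| <= e / S.
    by apply: ltW; exact: (vw.2 ord0 j).
  have wvj j : `|w ord0 j - v ord0 j| <= e / S by rewrite distrC.
  have eS : e / S * \sum_(j < d.+1) K j <= e.
    rewrite mulrAC ler_pdivrMr// ler_pM2l// /S lerDr//.
  have eS0 : 0 <= e / S by rewrite divr_ge0// ltW.
  have := Flip _ _ _ eS0 vwj; have := Flip _ _ _ eS0 wvj.
  by rewrite ler_distl; move=> *; apply/andP; split; lra.
have F0 (v : 'rV[R]_d.+1) : 0 <= F v by apply: fine_ge0; exact: Linfty_ge0.
pose A : set 'rV[R]_d.+1 :=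
  [set v | forall j, `[- (2 * F 0), 2 * F 0]%classic (v ord0 j)].
have A0 : A 0.
  by move=> j /=; rewrite mxE in_itv/= oppr_le0 mulr_ge0.
have cA : compact A.
  apply: (@rV_compact _ _ (fun=> `[- (2 * F 0), 2 * F 0]%classic)) => j.
  exact: segment_compact.
have [v vA vmin] :=
  @EVT_min_rV _ _ F A (ex_intro _ _ A0) cA (continuous_subspaceT cF).
exists (pv v); first by case: (hpv v).
move=> p dp; pose w : 'rV[R]_d.+1 :=
  \row_j mean1 h (horner p) (i0 + (j : nat)%:Z).
have pw : p = pv w.
  rewrite [LHS](hp (fun n => mean1 h (horner p) (i0 + n%:Z))) //.
  by apply: eq_bigr => j _; rewrite mxE.
rewrite pw -/I -/(E v) -/(E w) !EF lee_fin.
(* Outside the box some coordinate, a mean of p, exceeds 2 F(0). *)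
have [wA|] := pselect (A w); first by apply: vmin; rewrite inE.
move=> /existsNP[j] /negP; rewrite in_itv/= -ler_norml -ltNge mxE => Fw.
apply: (@le_trans _ _ (F 0)); first by apply: vmin; rewrite inE.
have [_] : lebesgue_measure.-integrable (mesh_interval h (i0 + (j : nat)%:Z) 1)
   (EFin \o horner p) /\ `|mean1 h (horner p) (i0 + (j : nat)%:Z)| <= F 0 + F w.
  apply: (mean1_bounded (D := I)) => //.
  - exact: measurable_itv.
  - exact: measurable_poly.
  - exact: sub_mesh_interval.
  - apply/Linfty_polyP => // x xI.
    (* The sup norm of p is at most F(0) + F(w). *)
    have -> : p.[x] = (psi x - (pv 0).[x]) - (psi x - (pv w).[x]).
      rewrite -pw (_ : (pv 0).[x] = 0); first by ring.
      by rewrite pvE big1// => i _; rewrite mxE mul0r.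
    by rewrite (le_trans (ler_normB _ _))// lerD ?FP.
lra.
Qed.

(** * Areas of cells cut by a graph *)

(** The inverses of [place]: they let the four orientations share the same
statements. *)
Definition indep (A : Type) (o : orientation) (z : A * A) : A :=
  match o with Y_le | Y_ge => z.1 | X_le | X_ge => z.2 end.

Definition dep (A : Type) (o : orientation) (z : A * A) : A :=
  match o with Y_le | Y_ge => z.2 | X_le | X_ge => z.1 end.

Lemma indep_place (A : Type) (o : orientation) (s t : A) :
  indep o (place o s t) = s.
Proof. by case: o. Qed.

Lemma dep_place (A : Type) (o : orientation) (s t : A) :
  dep o (place o s t) = t.
Proof. by case: o. Qed.

Lemma place_indep_dep (A : Type) (o : orientation) (z : A * A) :
  place o (indep o z) (dep o z) = z.
Proof. by case: o; case: z. Qed.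

(** As a function of t, a primitive of the indicator of the part of the fibre
which lies in the domain, when the graph is at height v on that fibre. *)
Definition cut (R : realType) (o : orientation) (v t : R) : R :=
  match o with Y_le | X_le => Num.min v t | Y_ge | X_ge => Num.max v t end.

Lemma cut_continuous (R : realType) (o : orientation) (t : R) :
  continuous (fun v => cut o v t).
Proof.
move=> v.
have cmin : {for v, continuous (fun w => Num.min w t)}.
  by apply: (@continuous_min R R id (cst t)); [exact: cvg_id|exact: cvg_cst].
have cmax : {for v, continuous (fun w => Num.max w t)}.
  by apply: (@continuous_max R R id (cst t)); [exact: cvg_id|exact: cvg_cst].
by case: o.
Qed.

Lemma side_length (R : realType) (o : orientation) (a b v : R) : a < b ->
  lebesgue_measure [set t | t \in `[a, b] /\ side o t v] =
  (cut o v b - cut o v a)%:E.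
Proof.
move=> ab.
have le_length : lebesgue_measure [set t | t \in `[a, b] /\ t <= v] =
    (Num.min v b - Num.min v a)%:E.
  rewrite (_ : mkset _ = `[a, Num.min v b]%classic); last first.
    apply/seteqP; split=> t /=; rewrite !in_itv/= le_min.
      by move=> [/andP[-> ->] ->].
    by move=> /and3P[-> -> ->].
  rewrite lebesgue_measure_itv/= lte_fin lt_min ab andbT.
  case: ltP => [av|va]; first by rewrite -EFinB.
  by rewrite min_l ?subrr// (le_trans va)// ltW.
have ge_length : lebesgue_measure [set t | t \in `[a, b] /\ v <= t] =
    (Num.max v b - Num.max v a)%:E.
  rewrite (_ : mkset _ = `[Num.max v a, b]%classic); last first.
    apply/seteqP; split=> t /=; rewrite !in_itv/= ge_max.
      by move=> [/andP[-> ->] ->].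
    by move=> /andP[/andP[-> ->] ->].
  rewrite lebesgue_measure_itv/= lte_fin gt_max ab andbT.
  case: ltP => [vb|bv]; first by rewrite -EFinB.
  by rewrite max_l ?subrr// (le_trans _ bv)// ltW.
by case: o.
Qed.

(** The product measure integrates sections in the first variable; when the
independent variable is the second one, the two iterated integrals are exchanged. *)
Lemma area_sections (R : realType) (o : orientation)
    (A : set (measurableTypeR R * measurableTypeR R)) : measurable A ->
  area R A = (\int[lebesgue_measure]_s
              lebesgue_measure [set t | A (place o s t)])%E.
Proof.
move=> mA.
have areaE : area R A = (\int[lebesgue_measure]_s
    lebesgue_measure (xsection A s))%E by [].
have swap :=
  indic_fubini_tonelli (@lebesgue_measure R) (@lebesgue_measure R) mA.
rewrite indic_fubini_tonelli_FE// indic_fubini_tonelli_GE// in swap.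
have xE s : xsection A s = [set t | A (s, t)].
  by apply/seteqP; split=> t; rewrite /xsection/= inE.
have yE s : ysection A s = [set t | A (t, s)].
  by apply/seteqP; split=> t; rewrite /ysection/= inE.
case: o => /=.
- by rewrite areaE; apply: eq_integral => s _; rewrite xE.
- by rewrite areaE; apply: eq_integral => s _; rewrite xE.
- by rewrite areaE [LHS]swap; apply: eq_integral => s _ /=; rewrite yE.
- by rewrite areaE [LHS]swap; apply: eq_integral => s _ /=; rewrite yE.
Qed.

Definition graph_side (R : realType) (o : orientation) (I : set R) (a b : R)
    (psi : R -> R) : set (measurableTypeR R * measurableTypeR R) :=
  [set z | [/\ I (indep o z), dep o z \in `[a, b] &
               side o (dep o z) (psi (indep o z))]].

Lemma graph_side_measurable (R : realType) (o : orientation) (I : set R)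
    (a b : R) (psi : R -> R) : measurable I -> measurable_fun I psi ->
  measurable (graph_side o I a b psi).
Proof.
move=> mI mpsi.
have mi : measurable_fun setT (@indep (measurableTypeR R) o).
  by clear; case: o; [exact: measurable_fst|exact: measurable_fst|
               exact: measurable_snd|exact: measurable_snd].
have md : measurable_fun setT (@dep (measurableTypeR R) o).
  by clear; case: o; [exact: measurable_snd|exact: measurable_snd|
               exact: measurable_fst|exact: measurable_fst].
pose B : set (measurableTypeR R * measurableTypeR R) :=
  (@indep (measurableTypeR R) o) @^-1` I `&`
  (@dep (measurableTypeR R) o) @^-1` `[a, b].
have mB : measurable B.
  apply: measurableI; rewrite -[X in measurable X]setTI.
    exact: mi.
  apply: md => //; exact: measurable_itv.
have mpi : measurable_fun B (psi \o @indep (measurableTypeR R) o).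
  apply: (measurable_comp mI _ mpsi).
    by move=> _ [z [zI _] <-].
  exact: measurable_funS mi.
have mdB : measurable_fun B (@dep (measurableTypeR R) o).
  exact: measurable_funS md.
have -> : graph_side o I a b psi =
    B `&` [set z | side o (dep o z) (psi (indep o z))].
  by apply/seteqP; split=> z /=; [move=> [? ? ?]|move=> [[]]].
clear mi md; case: o @B mB mpi mdB => B mB mpi mdB;
  by [exact: (measurable_fun_le mB mdB mpi)|exact: (measurable_fun_le mB mpi mdB)].
Qed.

Lemma area_graph_side (R : realType) (o : orientation) (I : set R) (a b : R)
    (psi : R -> R) : a < b -> measurable I -> measurable_fun I psi ->
  area R (graph_side o I a b psi) =
  (\int[lebesgue_measure]_(s in I) (cut o (psi s) b - cut o (psi s) a)%:E)%E.
Proof.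
move=> ab mI mpsi; rewrite (area_sections o (graph_side_measurable _ _ _ _ _))//.
rewrite [RHS]integral_mkcond; apply: eq_integral => s _.
rewrite patchE; case: ifPn => [/set_mem sI|/negP sI].
  rewrite -side_length//; congr (lebesgue_measure _).
  by apply/seteqP; split=> t; rewrite /graph_side/= indep_place dep_place => -[].
rewrite (_ : mkset _ = set0) ?measure0// -subset0 => t.
by rewrite /graph_side/= indep_place => -[+ _ _] => /mem_set.
Qed.

Lemma area_cell (R : realType) (h : R) (c : int * int) : 0 < h ->
  area R (cell h c) = (h ^+ 2)%:E.
Proof.
move=> h0; transitivity (lebesgue_measure (mesh_interval h c.1 1) *
  lebesgue_measure (mesh_interval h c.2 1))%E.
  by apply: product_measure1E; exact: measurable_itv.
by rewrite !mesh_interval_measure.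
Qed.

(** Omega agrees with a side of the graph on the cell only, and may be non
measurable elsewhere: the indicator is first replaced, on the cell, by that of a
measurable set. *)
Lemma cell_mean_graph (R : realType) (o : orientation) (h : R)
    (Omega : set (R * R)) (psi : R -> R) (i j : int) : 0 < h ->
  measurable_fun (mesh_interval h i 1) psi ->
  (forall s t, mesh_interval h i 1 s -> mesh_interval h j 1 t ->
     (Omega (place o s t) <-> side o t (psi s))) ->
  cell_mean h (\1_Omega : R * R -> R) (place o i j) =
  (h ^+ 2)^-1 * \int[lebesgue_measure]_(s in mesh_interval h i 1)
     (cut o (psi s) ((j + 1%:Z)%:~R * h) - cut o (psi s) (j%:~R * h)).
Proof.
move=> h0 mpsi Opsi; rewrite /cell_mean area_cell//; congr (_ * _).
have cE : cell h (place o i j) = [set z |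
    mesh_interval h i 1 (indep o z) /\ mesh_interval h j 1 (dep o z)].
  by rewrite /cell; case: (o) => /=; apply/seteqP; split=> -[x y] /= [].
have mI : measurable (mesh_interval h i 1) by exact: measurable_itv.
have mG := graph_side_measurable o (j%:~R * h) ((j + 1%:Z)%:~R * h) mI mpsi.
rewrite /Rintegral -area_graph_side//; last exact: mesh_step_gt0.
set G := graph_side _ _ _ _ _ in mG *; congr fine.
have GS : G `<=` cell h (place o i j).
  by rewrite cE => z [].
have mC : measurable (cell h (place o i j) :
    set (measurableTypeR R * measurableTypeR R)).
  apply: measurableX; exact: measurable_itv.
transitivity (\int[area R]_(z in cell h (place o i j)) (\1_G z)%:E)%E.
  apply: eq_integral => z; rewrite inE cE => -[zi zj]; congr EFin.
  rewrite !indicE; congr (_%:R); congr nat_of_bool.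
  have := Opsi _ _ zi zj; rewrite place_indep_dep => Oz.
  apply/idP/idP; rewrite !inE.
    by move=> /Oz.
  by move=> [_ _ /Oz].
by rewrite integral_indic// setIidl.
Qed.

(** * Recovery of the means and quasi-optimality *)

(** The cell means of a column telescope to the difference of the integrals of
[cut o psi] between the two ends of the column. As psi lies between these ends,
at one of them [cut] is the value of psi, and at the other it is that end. *)
Lemma aeros_data_mean (R : realType) (o : orientation) (h : R) (S : stencil)
    (Omega : set (R * R)) (psi : R -> R) (n : nat) : 0 < h ->
  {within I_ h S, continuous psi} -> graph_described o h S Omega psi ->
  (forall s, I_ h S s -> J_ h S (psi s)) -> (n <= km S + kp S)%N ->
  aeros_data o h S (\1_Omega : R * R -> R) n =
  mean1 h psi (iT S - (km S)%:Z + n%:Z).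
Proof.
move=> h0 cpsi Opsi Jpsi nS.
pose i := iT S - (km S)%:Z + n%:Z; pose j0 := jT S - (lm S)%:Z.
pose L := (lm S + lp S).+1; pose y (m : nat) : R := (j0 + m%:Z)%:~R * h.
have iI : mesh_interval h i 1 `<=` I_ h S by exact: sub_mesh_interval.
have mI : measurable (mesh_interval h i 1) by exact: measurable_itv.
have ci : {within mesh_interval h i 1, continuous psi}.
  exact: continuous_subspaceW cpsi.
have integ f : {within mesh_interval h i 1, continuous f} ->
    lebesgue_measure.-integrable (mesh_interval h i 1) (EFin \o f).
  by apply: continuous_compact_integrable; exact: segment_compact.
have icut t : lebesgue_measure.-integrable (mesh_interval h i 1)
    (EFin \o (fun s => cut o (psi s) t)).
  apply: integ.
  apply: (@within_continuous_comp _ _ _ _ psi (fun v => cut o v t)) ci.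
  by move=> v _; exact: cut_continuous.
pose G m := \int[lebesgue_measure]_(s in mesh_interval h i 1) cut o (psi s) (y m).
have cellE m : (m < L)%N ->
    cell_mean h (\1_Omega : R * R -> R) (place o i (j0 + m%:Z)) =
    (h ^+ 2)^-1 * (G m.+1 - G m).
  move=> mL; rewrite (@cell_mean_graph _ _ _ _ psi)//; last 2 first.
  - exact: subspace_continuous_measurable_fun.
  - move=> s t si tj; apply: Opsi; first exact: iI.
    exact: sub_mesh_interval tj.
  by rewrite RintegralB// mesh_nodeS.
have columnE : column_sum o h S (\1_Omega : R * R -> R) n =
    h^-1 * (G L - G 0%N).
  rewrite /column_sum
    (eq_big_nat _ _ (F2 := fun m => (h ^+ 2)^-1 * (G m.+1 - G m))).
    rewrite -mulr_sumr telescope_sumr// mulrA; congr (_ * _).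
    by rewrite expr2 invfM mulVKf// lt0r_neq0.
  by move=> m /andP[_ mL]; exact: cellE.
have Gcst c m : {in mesh_interval h i 1, forall s, cut o (psi s) (y m) = c} ->
    h^-1 * G m = c.
  move=> Gc; rewrite /G (@eq_Rintegral _ _ _ _ _ (cst c))// Rintegral_cst//.
  rewrite [X in _ * X](_ : _ = c * h); first by rewrite mulrC mulfK// lt0r_neq0.
  by congr (_ * _); exact: (congr1 fine (mesh_interval_measure i h0)).
have Gpsi m : {in mesh_interval h i 1, forall s, cut o (psi s) (y m) = psi s} ->
    h^-1 * G m = mean1 h psi i.
  by move=> Gs; rewrite /G (@eq_Rintegral _ (measurableTypeR R) _ _ _ psi).
have psiJ s : s \in mesh_interval h i 1 -> y 0%N <= psi s <= y L.
  rewrite inE => /iI/Jpsi; rewrite /J_ /mesh_interval/= in_itv/=.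
  by rewrite /y addr0.
have y0 : y 0%N = (jT S - (lm S)%:Z)%:~R * h by rewrite /y addr0.
have yL : y L = (jT S + (lp S)%:Z + 1)%:~R * h.
  rewrite /y /L /j0; congr (_%:~R * _); lia.
rewrite -/i; clearbody G; clear Opsi icut cellE.
case: o columnE Gcst Gpsi => columnE Gcst Gpsi.
all: rewrite /aeros_data columnE mulrBr -?y0 -?yL.
- by rewrite Gpsi ?(Gcst (y 0%N)) ?subrK// => s /psiJ/andP[? ?];
    [exact: min_r|exact: min_l].
- rewrite (Gcst (y L)) ?Gpsi; first by ring.
  + by move=> s /psiJ/andP[? ?]; exact: max_l.
  + by move=> s /psiJ/andP[? ?]; exact: max_r.
- by rewrite Gpsi ?(Gcst (y 0%N)) ?subrK// => s /psiJ/andP[? ?];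
    [exact: min_r|exact: min_l].
- rewrite (Gcst (y L)) ?Gpsi; first by ring.
  + by move=> s /psiJ/andP[? ?]; exact: max_l.
  + by move=> s /psiJ/andP[? ?]; exact: max_r.
Qed.

(** Transported to the reference interval, p - q is the projection of psi - q,
because the projection fixes q. *)
Lemma mean_projection_quasi_optimal (R : realType) (d : nat) (C h : R)
    (i0 : int) (psi : R -> R) (p q : {poly R}) :
  C%:E = mean_proj_norm R d -> 0 < h ->
  {within mesh_interval h i0 d.+1, continuous psi} ->
  has_means d h i0 (fun n => mean1 h psi (i0 + n%:Z)) p -> in_Pn d q ->
  (Linfty (mesh_interval h i0 d.+1) (fun x => psi x - p.[x])%R <=
   (1 + C)%:E *
   Linfty (mesh_interval h i0 d.+1) (fun x => psi x - q.[x])%R)%E.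
Proof.
move=> CE h0 cpsi [dp pm] dq; set I := mesh_interval h i0 d.+1.
have Ilt := mesh_interval_gt0 i0 d h0.
have ce (r : {poly R}) : {within I, continuous (fun x => psi x - r.[x])}.
  by apply: within_continuousB => //; exact: within_continuous_horner.
pose M := fine (Linfty I (fun x => psi x - q.[x])).
have ME : Linfty I (fun x => psi x - q.[x]) = M%:E.
  by rewrite fineK// Linfty_continuous_fin_num.
have eM x : x \in `[i0%:~R * h, (i0 + d.+1%:Z)%:~R * h] -> `|psi x - q.[x]| <= M.
  by move: x; apply/Linfty_continuousP => //; rewrite -ME.
pose F t : R := (i0%:~R + t) * h; pose g t := psi (F t) - q.[F t].
have FI : {homo F : t / @ref_interval R d t >-> I t}.
  move=> t; rewrite /ref_interval /I /mesh_interval/= !in_itv/= add0r mul0r mulr1.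
  by rewrite /F ler_pM2r// lerDl ler_pM2r// intrD lerD2l.
have cg : {within @ref_interval R d, continuous g}.
  apply: (within_continuous_comp_homo _ FI (ce q)); exact: continuous_affine.
have cI n : (n <= d)%N -> mesh_interval h (i0 + n%:Z) 1 `<=` I.
  by move=> nd; exact: sub_mesh_interval.
pose r := (p - q) \Po ((i0%:~R%:P + 'X) * h%:P).
have rE t : r.[t] = p.[F t] - q.[F t].
  by rewrite /r horner_comp !hornerE.
have gr : mean_proj d g = r.
  apply: mean_proj_uniq; split.
    rewrite /in_Pn (leq_trans (size_comp_poly_leq _ _))// ltnS.
    have s1 : (size ((i0%:~R%:P + 'X) * h%:P : {poly R})).-1 = 1%N.
      rewrite mulrC mul_polyC size_scale ?lt0r_neq0// addrC.
      by rewrite -[i0%:~R]opprK polyCN size_XsubC.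
    rewrite s1 muln1 -subn1 leq_subLR add1n (leq_trans (size_polyD _ _))//.
    by rewrite size_polyN geq_max; apply/andP; split.
  move=> n nd; rewrite add0r.
  have -> : mean1 1 (horner r) n = mean1 h (fun x => p.[x] - q.[x]) (i0 + n%:Z).
    rewrite mean1_rescale//; last first.
      by apply: within_continuousB; exact: within_continuous_horner.
    by congr mean1; apply/funext => t; exact: rE.
  have -> : mean1 1 g n = mean1 h (fun x => psi x - q.[x]) (i0 + n%:Z).
    by rewrite mean1_rescale//; apply: continuous_subspaceW (ce q); exact: cI.
  have integ f : {within I, continuous f} ->
      lebesgue_measure.-integrable (mesh_interval h (i0 + n%:Z) 1) (EFin \o f).
    move=> cf; apply: continuous_compact_integrable; first exact: segment_compact.
    by apply: continuous_subspaceW cf; exact: cI.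
  have mI : measurable (mesh_interval h (i0 + n%:Z) 1) by exact: measurable_itv.
  have := pm _ nd; rewrite /mean1 => pmn.
  have ipoly (f : {poly R}) := integ _ (@within_continuous_horner R I f).
  by rewrite !RintegralB ?mulrBr ?pmn//; exact: integ.
rewrite ME -EFinM; apply/Linfty_continuousP => // x xI.
pose t := x / h - i0%:~R.
have Ft : F t = x by rewrite /F /t addrC subrK divfK// lt0r_neq0.
have tI : t \in `[0%:~R * 1, (0 + d.+1%:Z)%:~R * 1].
  move: xI; rewrite -Ft !in_itv/= /F !ler_pM2r// lerDl intrD lerD2l.
  by rewrite add0r mul0r mulr1.
have gM s : s \in `[0%:~R * 1, (0 + d.+1%:Z)%:~R * 1] -> `|g s| <= M.
  by move=> sI; apply: eM; exact: (FI s sI).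
have := mean_proj_bound CE cg gM tI; rewrite gr rE Ft => rM.
have -> : psi x - p.[x] = (psi x - q.[x]) - (p.[x] - q.[x]) by ring.
by rewrite (le_trans (ler_normB _ _))// mulrDl mul1r lerD// eM.
Qed.

Theorem theorem4p2 (R : realType) (k : nat) (hk : (1 <= k)%N) :
  exists Chat : R, Chat%:E = mean_proj_norm R (2 * k) /\
  forall (h : R) (Omega : set (R * R)) (o : orientation) (S : stencil)
         (psi : R -> R),
    0 < h ->
    Omega `<=` `[0, 1] `*` `[0, 1] ->
    singular h Omega (target_cell o S) ->
    (km S + kp S = 2 * k)%N ->
    (0 < lm S)%N -> (0 < lp S)%N ->
    {within I_ h S, continuous psi} ->
    graph_described o h S Omega psi ->
    (forall s, I_ h S s -> J_ h S (psi s)) ->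
    exists pT : {poly R},
      unique (aeros o h S (\1_Omega : R * R -> R)) pT /\
      exists q : {poly R},
        [/\ in_Pn (2 * k) q,
            (forall p : {poly R}, in_Pn (2 * k) p ->
               (Linfty (I_ h S) (fun x => psi x - q.[x])%R
                <= Linfty (I_ h S) (fun x => psi x - p.[x])%R)%E) &
            (Linfty (I_ h S) (fun x => psi x - pT.[x])%R
             <= (1 + Chat)%:E
                * Linfty (I_ h S) (fun x => psi x - q.[x])%R)%E].
Proof.
have [C CE] := mean_proj_norm_fin R (2 * k).
exists C; split=> // h Omega o S psi h0 _ _ kS _ _ cpsi Opsi Jpsi.
have [p hp] := has_means_exists (km S + kp S) (iT S - (km S)%:Z)
  (aeros_data o h S (\1_Omega : R * R -> R)) h0.
exists p; split; first by split=> // p' hp'; exact: has_means_uniq hp hp'.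
have pm : has_means (2 * k) h (iT S - (km S)%:Z)
    (fun n => mean1 h psi (iT S - (km S)%:Z + n%:Z)) p.
  rewrite -kS; case: hp => dp mp; split=> // n nS.
  by rewrite mp// (aeros_data_mean h0 cpsi Opsi Jpsi nS).
rewrite /I_ kS in cpsi *.
have [q dq qmin] := best_approx h0 cpsi.
by exists q; split=> //; exact: mean_projection_quasi_optimal pm dq.
Qed.
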